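(* Any two signatures of the Petersen graph that are not switching isomorphic have different chromatic polynomials; in particular, they have different numbers $\chi_{(P,\sigma)}(3)$ of proper $1$-colorations.
   Context: The Petersen graph $P$ has vertices $v_{ij}$ for the 2-element subsets $\{i,j\}\subseteq\{1,\dots,5\}$, with $v_{ij}v_{kl}$ an edge iff $\{i,j\}\cap\{k,l\}=\emptyset$; a signature is $\sigma:E(P)\to\{+,-\}$. A proper $k$-coloration of $(P,\sigma)$ is $\kappa:V\to\{0,\pm1,\dots,\pm k\}$ with $\kappa(w)\neq\sigma(vw)\kappa(v)$ for every edge $vw$. The chromatic polynomial is the polynomial $\chi_{(P,\sigma)}$ with $\chi_{(P,\sigma)}(2k+1)=$ the number of proper $k$-colorations for all $k\ge0$. Switching by $\zeta:V\to\{+,-\}$ gives $\sigma^\zeta(vw)=\zeta(v)\sigma(vw)\zeta(w)$; two signatures are switching isomorphic if one is isomorphic (via a sign-preserving graph automorphism) to a switching of the other. *)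

(* Defs.v *)
From mathcomp Require Import all_boot all_order all_fingroup all_algebra.
Set Implicit Arguments.
Unset Strict Implicit.
Unset Printing Implicit Defensive.
Import Order.TTheory GRing.Theory Num.Theory.
Local Open Scope ring_scope.

Definition pvertex : Type := {A : {set 'I_5} | #|A| == 2}.

Definition padj (v w : pvertex) : bool := [disjoint val v & val w].

Definition is_pedge (e : {set pvertex}) : bool :=
  [exists v, exists w, padj v w && (e == [set v; w])].

Definition pedge : Type := {e : {set pvertex} | is_pedge e}.

(* Signs are booleans: true is the sign -, false is the sign +, so that the
   sign b stands for (-1) ^+ b and the product of signs is addb. *)
Definition signature : Type := {ffun pedge -> bool}.

(* The color set {0, +-1, ..., +-k} is encoded by 'I_(2k+1), with c standing
   for the integer c - k. *)
Definition color (k : nat) : Type := 'I_(k.*2.+1).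

Definition color_val (k : nat) (c : color k) : int := (nat_of_ord c)%:Z - k%:Z.

Definition coloration (k : nat) : Type := {ffun pvertex -> color k}.

Definition proper (sigma : signature) (k : nat) (kappa : coloration k) : bool :=
  [forall e : pedge, forall v : pvertex, forall w : pvertex,
    (val e == [set v; w]) ==>
    (color_val (kappa w) != (-1) ^+ sigma e * color_val (kappa v))].

Definition num_proper (sigma : signature) (k : nat) : nat :=
  #|[set kappa : coloration k | proper sigma kappa]|.

Definition is_chromatic_poly (sigma : signature) (p : {poly int}) : Prop :=
  forall k : nat, p.[(2 * k + 1)%N%:R] = (num_proper sigma k)%:R.

(* For e = {v, w} the iterated sum is the product zeta(v) zeta(w). *)
Definition switch (zeta : pvertex -> bool) (sigma : signature) : signature :=
  [ffun e : pedge => sigma e (+) \big[addb/false]_(v in val e) zeta v].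

Definition petersen_aut (phi : {perm pvertex}) : Prop :=
  forall v w : pvertex, padj (phi v) (phi w) = padj v w.

Definition sign_isomorphic (sigma tau : signature) : Prop :=
  exists2 phi : {perm pvertex}, petersen_aut phi &
    forall e e' : pedge, val e' = phi @: val e -> tau e' = sigma e.

Definition switching_isomorphic (sigma tau : signature) : Prop :=
  exists zeta : pvertex -> bool, sign_isomorphic sigma (switch zeta tau).

(* Existence of the chromatic polynomial, by deletion and contraction.  A triple
   (a, t, b) is the constraint x_a <> (-1)^t x_b, and count_sys A cs k counts the
   assignments that vanish off A and meet all the constraints in cs. *)

Definition color0 (k : nat) : color k := inord k.

Lemma color_val0 k : color_val (color0 k) = 0.
Proof.
by rewrite /color_val /color0 inordK ?subrr // ltnS -addnn leq_addr.
Qed.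

Lemma color_val_inj k : injective (@color_val k).
Proof. by move=> a b /addIr [] /val_inj. Qed.

Lemma color_valN k (c : color k) : color_val (rev_ord c : color k) = - color_val c.
Proof.
have ck : (c <= k.*2)%N by rewrite -ltnS ltn_ord.
rewrite /color_val /= subSS -(subzn ck); move: (nat_of_ord c) => m.
by rewrite opprB -addnn PoszD addrAC addrK.
Qed.

Definition color_sg k (s : bool) (c : color k) : color k :=
  if s then rev_ord c : color k else c.

Lemma color_val_sg k s (c : color k) :
  color_val (color_sg s c) = (-1) ^+ s * color_val c.
Proof. by case: s => /=; rewrite ?color_valN ?expr1 ?mulN1r ?expr0 ?mul1r. Qed.

Lemma color_sgD k s t (c : color k) :
  color_sg s (color_sg t c) = color_sg (s (+) t) c.
Proof. by case: s; case: t => //=; rewrite rev_ordK. Qed.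

Lemma color_sg_can k s : cancel (@color_sg k s) (@color_sg k s).
Proof. by move=> c; rewrite color_sgD addbb. Qed.

Lemma color_sg0 k s : color_sg s (color0 k) = color0 k.
Proof. by apply: color_val_inj; rewrite color_val_sg color_val0 mulr0. Qed.

Lemma color_sg_eq0 k s (c : color k) : (color_sg s c == color0 k) = (c == color0 k).
Proof. by rewrite -{1}(color_sg0 k s) (can_eq (@color_sg_can k s)). Qed.

Lemma color_rev_eq k (c : color k) : (c == color_sg true c) = (c == color0 k).
Proof.
apply/eqP/eqP => [cE|->]; last by rewrite color_sg0.
apply: color_val_inj; rewrite color_val0; apply/eqP.
have /eqP := congr1 (@color_val k) cE.
by rewrite color_val_sg expr1 mulN1r eq_sym eqNr.
Qed.

Section Systems.
Context {V : finType}.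
Implicit Types (A : {set V}) (c : V * bool * V) (cs : seq (V * bool * V)).

Definition sat k (x : {ffun V -> color k}) c : bool :=
  x c.1.1 != color_sg c.1.2 (x c.2).

Definition supp k A (x : {ffun V -> color k}) : bool :=
  [forall v, (v \notin A) ==> (x v == color0 k)].

Definition count_sys A cs k : nat :=
  #|[set x : {ffun V -> color k} | supp A x && all (sat x) cs]|.

Lemma suppP k A (x : {ffun V -> color k}) :
  reflect (forall v, v \notin A -> x v = color0 k) (supp A x).
Proof.
by apply: (iffP forallP) => H v; [move=> nA; apply/eqP; apply: (implyP (H v))
  | apply/implyP => /H ->].
Qed.

Lemma suppD1 k A i (x : {ffun V -> color k}) :
  supp (A :\ i) x = supp A x && (x i == color0 k).
Proof.
apply/suppP/andP => [H|[/suppP H /eqP x0] v].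
  split; last by rewrite H // !inE eqxx.
  by apply/suppP => v nA; apply: H; rewrite !inE negb_and nA orbT.
by rewrite !inE negb_and negbK => /orP[/eqP->|/H].
Qed.

Lemma count_sys_nil A k : count_sys A [::] k = ((2 * k + 1) ^ #|A|)%N.
Proof.
have := card_pffun_on (color0 k) (mem A) (predT : pred (color k)).
rewrite [#|predT|]card_ord addn1 mul2n => <-.
apply: eq_card => x; rewrite !inE andbT.
apply/suppP/pffun_onP => [H|[H _] v nA].
  split=> // ; apply/subsetP => v; rewrite inE; apply: contraR => nA.
  by rewrite H.
by apply/eqP; apply: contraR nA => h; apply: (subsetP H).
Qed.

Lemma count_sys_cons A c cs k :
  (count_sys A (c :: cs) k +
   #|[set x : {ffun V -> color k} | [&& supp A x, ~~ sat x c & all (sat x) cs]]|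
   = count_sys A cs k)%N.
Proof.
rewrite /count_sys -(cardsID [set x | sat x c]
  [set x : {ffun V -> color k} | supp A x && all (sat x) cs]).
by congr (_ + _)%N; apply: eq_card => x; rewrite !inE /=;
  case: (supp A x); case: (sat x c); rewrite /= ?andbT ?andbF.
Qed.

Definition subst (i : V) (s : bool) (j : V) c : V * bool * V :=
  (if c.1.1 == i then j else c.1.1,
   c.1.2 (+) (s && (c.1.1 == i)) (+) (s && (c.2 == i)),
   if c.2 == i then j else c.2).

Lemma sat_subst k i s j c (x : {ffun V -> color k}) :
  sat [ffun v => if v == i then color_sg s (x j) else x v] c =
  sat x (subst i s j c).
Proof.
case: c => [[a t] b]; rewrite /sat /= !ffunE.
case: (a == i); case: (b == i); rewrite ?andbT ?andbF ?addbF //.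
- by rewrite -[in RHS](can_eq (@color_sg_can k s)) !color_sgD;
    congr (_ != color_sg _ _); case: s; case: t.
- by rewrite -[in RHS](can_eq (@color_sg_can k s)) !color_sgD;
    congr (_ != color_sg _ _); case: s; case: t.
- by rewrite color_sgD.
Qed.

Lemma count_sys_subst A i s j cs k : i != j -> i \in A -> j \in A ->
  #|[set x : {ffun V -> color k} |
      [&& supp A x, ~~ sat x (i, s, j) & all (sat x) cs]]|
  = count_sys (A :\ i) (map (subst i s j) cs) k.
Proof.
move=> ij iA jA.
pose g (x : {ffun V -> color k}) : {ffun V -> color k} :=
  [ffun v => if v == i then color_sg s (x j) else x v].
have satg x cs' : all (sat (g x)) cs' = all (sat x) (map (subst i s j) cs').
  by rewrite all_map; apply: eq_all => c; rewrite /= -sat_subst.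
rewrite /count_sys -[RHS](card_in_imset (f := g)); last first.
  move=> x y; rewrite !inE !suppD1 => /andP[/andP[_ /eqP xi] _].
  move=> /andP[/andP[_ /eqP yi] _] /ffunP gE; apply/ffunP => v.
  by have := gE v; rewrite !ffunE; case: eqP => [->|//]; rewrite xi yi.
apply: eq_card => x; rewrite [LHS]inE; apply/idP/imsetP.
  case/and3P=> /suppP sx; rewrite /sat /= negbK => /eqP xi sc.
  pose y : {ffun V -> color k} := [ffun v => if v == i then color0 k else x v].
  have xE : x = g y.
    apply/ffunP => v; rewrite !ffunE eq_sym [j == i]eq_sym (negPf ij).
    by case: eqP => // <-.
  exists y => //; rewrite inE -satg -xE sc andbT suppD1 ffunE !eqxx andbT.
  by apply/suppP => v nA; rewrite ffunE sx //; case: ifP.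
case=> y; rewrite inE -satg suppD1 => /andP[/andP[/suppP sy yi] sc] ->.
rewrite sc andbT; apply/andP; split.
  apply/suppP => v nA; rewrite ffunE; case: eqP => [vi|_]; last exact: sy.
  by rewrite vi iA in nA.
by rewrite /sat /= !ffunE eqxx [j == i]eq_sym (negPf ij) negbK.
Qed.

Lemma count_sys_poly cs A :
  {p : {poly int} | forall k, p.[(2 * k + 1)%N%:R] = (count_sys A cs k)%:R}.
Proof.
have [n] := ubnP (size cs); elim: n => // n IHn in cs A *.
case: cs => [_|[[i s] j] cs] /=.
  by exists ('X^#|A|) => k; rewrite hornerXn count_sys_nil natrX.
rewrite ltnS => szcs.
suff [q qE] : {q : {poly int} | forall k, q.[(2 * k + 1)%N%:R] =
    #|[set x : {ffun V -> color k} |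
        [&& supp A x, ~~ sat x (i, s, j) & all (sat x) cs]]|%:R}.
  have [p pE] := IHn cs A szcs; exists (p - q) => k.
  by rewrite hornerD hornerN pE qE -(count_sys_cons A (i, s, j)) natrD addrK.
have zero l : (forall k (x : {ffun V -> color k}), supp A x ->
    (x i == color_sg s (x j)) = (x l == color0 k)) ->
  {q : {poly int} | forall k, q.[(2 * k + 1)%N%:R] =
    #|[set x : {ffun V -> color k} |
        [&& supp A x, ~~ sat x (i, s, j) & all (sat x) cs]]|%:R}.
  move=> H; have [q qE] := IHn cs (A :\ l) szcs; exists q => k; rewrite qE.
  congr (_%:R); apply: eq_card => x; rewrite !inE suppD1 -andbA.
  by case sx: (supp A x) => //=; rewrite /sat /= negbK H.
case iA: (i \in A); last first.
  apply: (zero j) => k x /suppP -> //; last by rewrite iA.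
  by rewrite eq_sym color_sg_eq0.
case jA: (j \in A); last first.
  by apply: (zero i) => k x /suppP sx; rewrite (sx j) ?jA // color_sg0.
case: (eqVneq i j) => [ij|ij]; last first.
  have [|q qE] := IHn (map (subst i s j) cs) (A :\ i); first by rewrite size_map.
  by exists q => k; rewrite qE count_sys_subst.
case: s zero => zero.
  by apply: (zero i) => k x _; rewrite -ij color_rev_eq.
have [q qE] := IHn cs A szcs; exists q => k; rewrite qE; congr (_%:R).
by apply: eq_card => x; rewrite !inE /sat /= -ij eqxx.
Qed.

End Systems.

Lemma chromatic_poly_exists (sigma : signature) :
  {p : {poly int} | is_chromatic_poly sigma p}.
Proof.
pose cs := [seq (q.2, sigma q.1.1, q.1.2) |
  q <- enum [pred q : pedge * pvertex * pvertex |
              val q.1.1 == [set q.1.2; q.2]]].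
have [p pE] := count_sys_poly cs [set: pvertex].
exists p => k; rewrite pE; congr (_%:R); apply: eq_card => x; rewrite !inE.
have -> : supp [set: pvertex] x by apply/suppP => v; rewrite inE.
rewrite /= /cs all_map; apply/allP/idP => [H|H q].
  apply/forallP => e; apply/forallP => v; apply/forallP => w.
  apply/implyP => evw; have := H (e, v, w); rewrite mem_enum => /(_ evw).
  by rewrite /= /sat /= -color_val_sg (inj_eq (@color_val_inj k)).
case: q => [[e v] w]; rewrite mem_enum inE /= => evw.
move/forallP/(_ e)/forallP/(_ v)/forallP/(_ w)/implyP/(_ evw): H.
by rewrite /sat /= -color_val_sg (inj_eq (@color_val_inj k)).
Qed.

Lemma chromatic_poly_unique (sigma : signature) (p q : {poly int}) :
  is_chromatic_poly sigma p -> is_chromatic_poly sigma q -> p = q.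
Proof.
move=> pP qP; apply/eqP; rewrite -subr_eq0; apply/negPn/negP => nz.
pose rs : seq int := [seq (2 * k + 1)%N%:R | k <- iota 0 (size (p - q)%R)].
have : (size rs < size (p - q)%R)%N.
  apply: max_poly_roots => //.
    by apply/allP => _ /mapP[k _ ->]; rewrite rootE hornerD hornerN pP qP subrr.
  rewrite map_inj_uniq ?iota_uniq // => a b /eqP.
  by rewrite eqr_nat eqn_add2r eqn_pmul2l // => /eqP.
by rewrite size_map size_iota ltnn.
Qed.

Definition chromatic_poly (sigma : signature) : {poly int} :=
  sval (chromatic_poly_exists sigma).

Lemma chromatic_polyP (sigma : signature) :
  is_chromatic_poly sigma (chromatic_poly sigma).
Proof. exact: svalP (chromatic_poly_exists sigma). Qed.

(* Main.v *)
From HB Require Import structures.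
Require Import Defs.
From mathcomp Require Import all_boot all_order all_fingroup all_algebra.
Import GRing.Theory.
Local Open Scope ring_scope.

(* Switching along a spanning tree makes all tree edges positive, so that every
   signature is switching equivalent to one of the 2^6 sign vectors on the six
   remaining edges.  Under automorphisms these fall into six classes, of sizes
   1, 15, 15, 30, 2 and 1.  The number of proper 1-colorations is invariant under
   switching isomorphism, and takes the distinct values 120, 112, 136, 108, 80
   and 202 on the six classes. *)

(** * Signs on adjacent pairs, and invariance of the counts under switching isomorphism *)

Lemma padj_sym : symmetric padj.
Proof. by move=> v w; rewrite /padj disjoint_sym. Qed.

Lemma padjxx v : padj v v = false.
Proof.
apply/negP; rewrite /padj -setI_eq0 setIid -cards_eq0.
by rewrite (eqP (valP v)).
Qed.

Lemma padj_neq v w : padj v w -> v != w.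
Proof. by apply: contraTneq => ->; rewrite padjxx. Qed.

Lemma is_pedge_set2 v w : padj v w -> is_pedge [set v; w].
Proof.
by move=> vw; apply/existsP; exists v; apply/existsP; exists w; rewrite vw eqxx.
Qed.

Lemma pedgeP (e : pedge) : exists v w, padj v w /\ val e = [set v; w].
Proof. by case/existsP: (valP e) => v /existsP[w /andP[vw /eqP eE]]; exists v, w. Qed.

Lemma pedge_padj (e : pedge) v w : val e = [set v; w] -> padj v w.
Proof.
have [a [b [ab ->]]] := pedgeP e => /setP abvw.
move: (abvw a) (abvw b) (abvw v) (abvw w); rewrite !inE !eqxx ?orbT /=.
move/esym/orP => [] /eqP <-; move/esym/orP=> [] /eqP // E.
- by rewrite E padjxx in ab.
- by rewrite -E.
- by rewrite -E padj_sym.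
- by rewrite E padjxx in ab.
Qed.

(** Reading signs from pairs of vertices avoids carrying proofs of [is_pedge]; non-edges get the
    default sign +. *)
Definition sgn (sigma : signature) (v w : pvertex) : bool :=
  if insub [set v; w] is Some e then sigma (e : pedge) else false.

Lemma sgnE sigma (e : pedge) v w : val e = [set v; w] -> sgn sigma v w = sigma e.
Proof. by rewrite /sgn => <-; rewrite valK. Qed.

Lemma sgnC sigma v w : sgn sigma v w = sgn sigma w v.
Proof. by rewrite /sgn setUC. Qed.

Lemma properP sigma k (kappa : coloration k) :
  reflect (forall v w, padj v w -> kappa w != color_sg (sgn sigma v w) (kappa v))
          (Defs.proper sigma kappa).
Proof.
apply: (iffP forallP) => [H v w vw|H e].
  have /forallP/(_ v)/forallP/(_ w) := H (Sub [set v; w] (is_pedge_set2 _ _ vw)).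
  rewrite SubK eqxx /= -color_val_sg (inj_eq (@color_val_inj k)).
  by rewrite (sgnE _ (Sub _ (is_pedge_set2 _ _ vw))).
apply/forallP => v; apply/forallP => w; apply/implyP => /eqP eE.
rewrite -color_val_sg (inj_eq (@color_val_inj k)) -(sgnE _ _ _ _ eE).
exact: H (pedge_padj _ _ _ eE).
Qed.

(** Moving the switching function from the side of [tau] to the domain of [phi] gives a form that is
    easy to invert and to compose. *)
Lemma switching_isomorphicP sigma tau :
  switching_isomorphic sigma tau <->
  exists2 phi, petersen_aut phi & exists zeta : pvertex -> bool, forall v w,
    padj v w -> sgn tau (phi v) (phi w) = sgn sigma v w (+) zeta v (+) zeta w.
Proof.
have big_pair (zeta : pvertex -> bool) v w : padj v w ->
    \big[addb/false]_(u in [set v; w]) zeta u = zeta v (+) zeta w.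
  by move/padj_neq => vw; rewrite big_setU1 ?big_set1 ?inE.
have img phi (v w : pvertex) : phi @: [set v; w] = [set phi v; phi w].
  by rewrite imsetU1 imset_set1.
split=> [[zeta [phi phiA phiE]]|[phi phiA [zeta zetaE]]].
  exists phi => //; exists (zeta \o phi) => v w vw.
  have vw' : padj (phi v) (phi w) by rewrite phiA.
  pose e : pedge := Sub _ (is_pedge_set2 _ _ vw).
  pose e' : pedge := Sub _ (is_pedge_set2 _ _ vw').
  have := phiE e e'; rewrite !SubK img => /(_ erefl).
  rewrite ffunE SubK big_pair // (sgnE _ e v w) // (sgnE _ e' (phi v) (phi w)) //= => <-.
  by case: (tau _); case: (zeta _); case: (zeta _).
exists (zeta \o phi^-1%g), phi => // e e'.
have [v [w [vw eE]]] := pedgeP e; rewrite eE img => eE'.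
rewrite ffunE eE' big_pair ?phiA //= !permK -(sgnE _ _ _ _ eE) -(sgnE _ _ _ _ eE').
by rewrite zetaE //; case: (sgn _ _ _); case: (zeta v); case: (zeta w).
Qed.

Lemma switching_isomorphic_sym sigma tau :
  switching_isomorphic sigma tau -> switching_isomorphic tau sigma.
Proof.
move/switching_isomorphicP => [phi phiA [zeta zetaE]].
apply/switching_isomorphicP; exists phi^-1%g.
  by move=> v w; rewrite -[in RHS](permKV phi v) -[in RHS](permKV phi w) phiA.
exists (zeta \o phi^-1%g) => v w vw /=.
have := zetaE (phi^-1 v)%g (phi^-1 w)%g; rewrite -phiA !permKV => -> //.
by case: (sgn _ _ _); case: (zeta _); case: (zeta _).
Qed.

Lemma switching_isomorphic_trans rho sigma tau :
  switching_isomorphic sigma rho -> switching_isomorphic rho tau ->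
  switching_isomorphic sigma tau.
Proof.
move=> /switching_isomorphicP[phi phiA [zeta zetaE]].
move=> /switching_isomorphicP[psi psiA [eta etaE]].
apply/switching_isomorphicP; exists (phi * psi)%g.
  by move=> v w; rewrite !permM psiA phiA.
exists (fun v => zeta v (+) eta (phi v)) => v w vw.
rewrite !permM etaE ?phiA // zetaE //.
by case: (sgn _ _ _); case: (zeta v); case: (zeta w); case: (eta _); case: (eta _).
Qed.

(** Pulling a coloration back along [phi] and negating it where [zeta] is - is injective and keeps
    properness. Symmetry of the relation then gives equality. *)
Lemma num_proper_switching_le sigma tau k :
  switching_isomorphic sigma tau -> (num_proper tau k <= num_proper sigma k)%N.
Proof.
move/switching_isomorphicP => [phi phiA [zeta zetaE]].
pose f (kappa : coloration k) : coloration k :=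
  [ffun v => color_sg (zeta v) (kappa (phi v))].
rewrite /num_proper -(@card_imset _ _ f); last first.
  move=> x y /ffunP fE; apply/ffunP => v; have := fE (phi^-1 v)%g.
  by rewrite !ffunE permKV => /(can_inj (@color_sg_can k _)).
apply/subset_leq_card/subsetP => _ /imsetP[x + ->]; rewrite !inE => /properP px.
apply/properP => v w vw; rewrite !ffunE color_sgD.
have := px (phi v) (phi w); rewrite phiA => /(_ vw); rewrite zetaE //.
rewrite -(inj_eq (can_inj (@color_sg_can k (zeta w)))) color_sgD.
by congr (_ != color_sg _ _); case: (zeta v); case: (zeta w); case: (sgn _ _ _).
Qed.

Lemma num_proper_switching sigma tau k :
  switching_isomorphic sigma tau -> num_proper sigma k = num_proper tau k.
Proof.
move=> st; apply/eqP; rewrite eqn_leq !num_proper_switching_le //.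
exact: switching_isomorphic_sym.
Qed.

(** * A computable model on the indices 0 to 9, and normalization along the tree *)

Local Open Scope nat_scope.

(* The ten vertices in breadth-first order from v_12 (symbols shifted to start
   at 0), so that [parent] below describes a spanning tree of depth 2. *)
Definition vert (i : nat) : nat * nat :=
  nth (0, 0) [:: (0, 1); (2, 3); (2, 4); (3, 4);
    (1, 4); (0, 4); (1, 3); (0, 3); (1, 2); (0, 2)] i.

Definition vert_index (a b : nat) : nat :=
  index (minn a b, maxn a b) (map vert (iota 0 10)).

Definition adjb (i j : nat) : bool :=
  let: (a, b) := vert i in let: (c, d) := vert j in
  [&& a != c, a != d, b != c & b != d].

Definition edges : seq (nat * nat) := Eval vm_compute in
  [seq p <- [seq (i, j) | i <- iota 0 10, j <- iota 0 10] |
    (p.1 < p.2) && adjb p.1 p.2].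

Definition parent (j : nat) : nat := nth 0 [:: 0; 0; 0; 0; 1; 1; 2; 2; 3; 3] j.

Definition cotree : seq (nat * nat) := Eval vm_compute in
  [seq p <- edges | parent p.2 != p.1].

(* The tree edges are positive: they are not in [cotree], so that [index] falls
   outside [b] and [nth] gives the default. *)
Definition bits_sgn (b : seq bool) (i j : nat) : bool :=
  nth false b (index (minn i j, maxn i j) cotree).

(* The sum of [D] along the tree path from the root to [i]; since the tree has
   depth 2 there are at most two terms. *)
Definition potential (D : nat -> nat -> bool) (i : nat) : bool :=
  (parent i != 0) && D 0 (parent i) (+) (i != 0) && D (parent i) i.

Definition normal_bits (D : nat -> nat -> bool) : seq bool :=
  [seq D p.1 p.2 (+) potential D p.1 (+) potential D p.2 | p <- cotree].

(** The automorphisms induced by the 120 permutations of the five symbols, each stored as its list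
    of images of the indices. *)
Definition auts : seq (seq nat) := Eval vm_compute in
  [seq [seq vert_index (nth 0 s (vert i).1) (nth 0 s (vert i).2) | i <- iota 0 10]
  | s <- permutations (iota 0 5)].

Lemma lt10P (P : pred nat) : all P (iota 0 10) -> forall i, i < 10 -> P i.
Proof. by move=> /allP H i i10; apply: H; rewrite mem_iota. Qed.

Lemma normal_bits_ext D D' :
  (forall i j, (i, j) \in edges -> D i j = D' i j) -> normal_bits D = normal_bits D'.
Proof. by move=> H; rewrite /normal_bits /= /potential /= !H. Qed.

Lemma adjbC i j : adjb i j = adjb j i.
Proof.
rewrite /adjb; case: (vert i) (vert j) => a b [c d].
rewrite (eq_sym c a) (eq_sym c b) (eq_sym d a) (eq_sym d b).
by case: (a == c); case: (a == d); case: (b == c); case: (b == d).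
Qed.

Lemma bits_sgnC b i j : bits_sgn b i j = bits_sgn b j i.
Proof. by rewrite /bits_sgn minnC maxnC. Qed.

Lemma mem_edges i j : i < j < 10 -> adjb i j -> (i, j) \in edges.
Proof.
have H : all (fun j => all (fun i => (i < j) ==> adjb i j ==> ((i, j) \in edges))
  (iota 0 10)) (iota 0 10) by vm_compute.
case/andP=> ij j10; move: (lt10P _ (lt10P _ H j j10) i (ltn_trans ij j10)).
by rewrite ij /= => /implyP.
Qed.

Lemma edgesP i j : (i, j) \in edges -> [/\ i < j, j < 10 & adjb i j].
Proof.
have /allP H : all (fun p => [&& p.1 < p.2, p.2 < 10 & adjb p.1 p.2]) edges by vm_compute.
by move/H => /and3P.
Qed.

(** Switching by the potential keeps the bits recorded on the cotree. On a tree edge the two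
    potentials differ by exactly [D i j], so the switched sign is +. *)
Lemma bits_sgn_normal (D : nat -> nat -> bool) i j :
  (forall i j, D i j = D j i) -> i < 10 -> j < 10 -> adjb i j ->
  bits_sgn (normal_bits D) i j = D i j (+) potential D i (+) potential D j.
Proof.
move=> DC; wlog ij : i j / i <= j => [H i10 j10 aij|i10 j10 aij].
  have [/H -> //|ji] := leqP i j.
  by rewrite bits_sgnC H 1?adjbC ?(ltnW ji) // DC addbAC.
have {}ij : i < j.
  rewrite ltn_neqAle ij andbT; apply: contraTneq aij => ->.
  by rewrite /adjb; case: (vert j) => a b; rewrite eqxx.
have ije : (i, j) \in edges by apply: mem_edges; rewrite // ij.
rewrite /bits_sgn (minn_idPl (ltnW ij)) (maxn_idPr (ltnW ij)).
have [ijc|ijc] := boolP ((i, j) \in cotree).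
  by rewrite (nth_map (0, 0)) ?index_mem // nth_index.
(* An edge outside the cotree joins a parent of depth at most 1 to its child. *)
have /allP/(_ _ ije) : all (fun p => (p \in cotree) ||
    [&& p.1 == parent p.2, parent p.1 == 0 & p.2 != 0]) edges by vm_compute.
rewrite (negPf ijc) => /and3P[/eqP /= pj /eqP pi j0].
rewrite nth_default; last by move: ijc; rewrite -index_mem -leqNgt.
rewrite /potential -pj pi eqxx j0 /=.
by case: (D i j); case: (i == 0); case: (D 0 i).
Qed.

(** * Transfer between indices and vertices *)

Definition vtx0 : pvertex.
Proof. by exists [set ord0; ord_max]; rewrite cards2. Defined.

(* Locked, like [vtx_index], because a failing unification of [vtx (vtx_index v)] with
   [vtx (vtx_index w)] would unfold both sides without end. *)
HB.lock Definition vtx (i : nat) : pvertex :=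
  insubd vtx0 [set inord (vert i).1; inord (vert i).2].

HB.lock Definition vtx_index (v : pvertex) : nat := index v (map vtx (iota 0 10)).

Lemma inord_eq a b : a < 5 -> b < 5 -> (inord a == inord b :> 'I_5) = (a == b).
Proof. by move=> a5 b5; rewrite -val_eqE /= !inordK. Qed.

Lemma vertP i : i < 10 -> [&& (vert i).1 < 5, (vert i).2 < 5 & (vert i).1 != (vert i).2].
Proof. by move: i; apply: lt10P; vm_compute. Qed.

Lemma val_vtx i : i < 10 -> val (vtx i) = [set inord (vert i).1; inord (vert i).2].
Proof.
by move=> /vertP/and3P[a5 b5 ab]; rewrite vtx.unlock insubdK // -topredE /= cards2
  inord_eq // ab.
Qed.

Lemma padj_vtx i j : i < 10 -> j < 10 -> padj (vtx i) (vtx j) = adjb i j.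
Proof.
move=> i10 j10; rewrite /padj !val_vtx // /adjb.
have /and3P[] := vertP i i10; have /and3P[] := vertP j j10.
case: (vert i) (vert j) => a b [c d] /= c5 d5 _ a5 b5 _.
by rewrite disjoints_subset subUset !sub1set !inE !inord_eq // !negb_or -andbA.
Qed.

(** Distinct vertices of the Petersen graph have distinct neighborhoods, so injectivity reduces to a
    computation with [adjb]. *)
Lemma vtx_inj i j : i < 10 -> j < 10 -> vtx i = vtx j -> i = j.
Proof.
move=> i10 j10 ij; apply/eqP.
have : all (fun k => adjb i k == adjb j k) (iota 0 10).
  by apply/allP => k; rewrite mem_iota => /= k10; rewrite -!padj_vtx // ij.
apply/implyP; move: j j10 {ij}; apply: lt10P; move: i i10; apply: lt10P.
by vm_compute.
Qed.

Lemma vtx_surj v : exists2 i, i < 10 & vtx i = v.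
Proof.
have /cards2P[a [b [ab vE]]] := valP v.
have H : all (fun a => all (fun b => (a != b) ==> (vert_index a b < 10) &&
    (vert (vert_index a b) \in [:: (a, b); (b, a)])) (iota 0 5)) (iota 0 5).
  by vm_compute.
have {}H := allP (allP H a _) b _; rewrite !mem_iota !ltn_ord in H.
have /implyP/(_ ab)/andP[i10 iE] := H isT isT.
exists (vert_index a b) => //; apply: val_inj; rewrite val_vtx // vE.
by move: iE; rewrite !inE => /orP[] /eqP->; rewrite /= !inord_val // setUC.
Qed.

Lemma vtx_index_lt v : vtx_index v < 10.
Proof.
have [i i10 <-] := vtx_surj v.
by rewrite vtx_index.unlock -[10](size_map vtx (iota 0 10)) index_mem map_f // mem_iota.
Qed.

Lemma vtx_indexK v : vtx (vtx_index v) = v.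
Proof.
have := vtx_index_lt v; rewrite vtx_index.unlock => v10.
have vin : v \in map vtx (iota 0 10) by rewrite -index_mem size_map size_iota.
by rewrite -[RHS](nth_index vtx0 vin) (nth_map 0) ?size_iota // nth_iota.
Qed.

Lemma padjE v w : padj v w = adjb (vtx_index v) (vtx_index w).
Proof. by rewrite -padj_vtx ?vtx_index_lt ?vtx_indexK. Qed.

Lemma vtxK i : i < 10 -> vtx_index (vtx i) = i.
Proof. by move=> i10; apply: vtx_inj; rewrite ?vtx_index_lt ?vtx_indexK. Qed.

(** An edge is an unordered set, so its sign is read from some ordering of its ends; by [bits_sgnC]
    both orderings agree. *)
Definition bits_signature (b : seq bool) : signature :=
  [ffun e : pedge => [exists v in val e, exists w in val e,
     (v != w) && bits_sgn b (vtx_index v) (vtx_index w)]].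

Lemma sgn_bits_signature b i j : i < 10 -> j < 10 -> adjb i j ->
  sgn (bits_signature b) (vtx i) (vtx j) = bits_sgn b i j.
Proof.
move=> i10 j10; rewrite -padj_vtx // => ij.
rewrite (sgnE _ (Sub _ (is_pedge_set2 _ _ ij))) // ffunE SubK.
apply/exists_inP/idP => [[v]|H].
  rewrite !inE => /orP[]/eqP -> /exists_inP[w]; rewrite !inE => /orP[]/eqP->;
    rewrite ?eqxx //= !vtxK // => /andP[_] //.
  by rewrite bits_sgnC.
exists (vtx i); rewrite ?set21 //; apply/exists_inP; exists (vtx j); rewrite ?set22 //.
by rewrite (padj_neq _ _ ij) !vtxK.
Qed.

(** * Normal forms and the six classes *)

Lemma autsP q : q \in auts ->
  [/\ forall i, i < 10 -> nth 0 q i < 10,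
      forall i j, i < 10 -> j < 10 -> nth 0 q i = nth 0 q j -> i = j &
      forall i j, i < 10 -> j < 10 -> adjb (nth 0 q i) (nth 0 q j) = adjb i j].
Proof.
have /allP H : all (fun q => [&& size q == 10, all (gtn 10) q, uniq q &
    all (fun i => all (fun j => adjb (nth 0 q i) (nth 0 q j) == adjb i j)
      (iota 0 10)) (iota 0 10)]) auts by vm_compute.
move/H => /and4P[/eqP sq /allP q10 uq adjq]; split=> [i i10|i j i10 j10 /eqP|i j i10 j10].
- by apply: q10; rewrite mem_nth ?sq.
- by rewrite nth_uniq ?sq // => /eqP.
- exact/eqP/(lt10P _ (lt10P _ adjq i i10) j j10).
Qed.

(** Pull [tau] back along [q], then switch by the potential of the pulled-back signs. The identity
    normalizes [tau]; other choices of [q] give further normal forms in the same class. *)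
Lemma normal_form tau q : q \in auts ->
  switching_isomorphic
    (bits_signature (normal_bits (fun i j =>
      sgn tau (vtx (nth 0 q i)) (vtx (nth 0 q j))))) tau.
Proof.
move=> /autsP[q10 q_inj q_adj]; apply/switching_isomorphicP.
pose D i j := sgn tau (vtx (nth 0 q i)) (vtx (nth 0 q j)); rewrite -/D.
pose phi v := vtx (nth 0 q (vtx_index v)).
have phi_inj : injective phi.
  move=> v w fvw; have v10 := vtx_index_lt v; have w10 := vtx_index_lt w.
  have vw := q_inj _ _ v10 w10 (vtx_inj _ _ (q10 _ v10) (q10 _ w10) fvw).
  by rewrite -[v]vtx_indexK vw vtx_indexK.
exists (perm phi_inj).
  move=> v w; rewrite !permE /phi padj_vtx ?q10 ?vtx_index_lt // q_adj ?vtx_index_lt //.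
  by rewrite padjE.
exists (fun v => potential D (vtx_index v)) => v w.
rewrite !permE /phi -{1 3}[v]vtx_indexK -{1 3}[w]vtx_indexK.
have := vtx_index_lt v; have := vtx_index_lt w.
move: (vtx_index v) (vtx_index w) => i j j10 i10; rewrite padj_vtx // => ij.
rewrite sgn_bits_signature // bits_sgn_normal // => [|k l]; last exact: sgnC.
by rewrite -/(D i j); case: (D i j); case: (potential D i); case: (potential D j).
Qed.

(* All zeros is the balanced class, all ones the antibalanced one. *)
Definition reps : seq (seq bool) := [seq map odd s | s <- [::
  [:: 0; 0; 0; 0; 0; 0]; [:: 0; 0; 0; 0; 0; 1]; [:: 0; 0; 0; 0; 1; 1];
  [:: 0; 0; 0; 1; 1; 0]; [:: 0; 1; 1; 0; 0; 1]; [:: 1; 1; 1; 1; 1; 1]]].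

Definition bits (n : nat) : seq (seq bool) :=
  iter n (fun l => [seq x :: s | x <- [:: false; true], s <- l]) [:: [::]].

Lemma mem_bits s : s \in bits (size s).
Proof.
by elim: s => // x s IH; apply: (allpairs_f cons) => //; case: x.
Qed.

Definition orbit_bits : seq (seq bool) :=
  [seq normal_bits (fun i j => bits_sgn r (nth 0 q i) (nth 0 q j))
  | r <- reps, q <- auts].

(** The finite check behind the classification: the orbits of the six representatives cover all 64
    sign vectors. *)
Lemma orbit_bits_all : all (mem orbit_bits) (bits 6).
Proof. by vm_compute. Qed.

Lemma switching_classes sigma :
  exists2 r, r \in reps & switching_isomorphic sigma (bits_signature r).
Proof.
have id_aut : iota 0 10 \in auts by vm_compute.
have := normal_form sigma _ id_aut.
set b := normal_bits _ => /switching_isomorphic_sym sb.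
have /allpairsP[[r q] /= [rR qA bE]] : b \in orbit_bits.
  exact: (allP orbit_bits_all) (mem_bits b).
exists r => //; apply: (switching_isomorphic_trans (bits_signature b)) => //.
(* Up to replacing [sgn] by [bits_sgn], which agree on edges, [b] is the normal form of
   [bits_signature r] along [q]. *)
have := normal_form (bits_signature r) _ qA;
congr switching_isomorphic; congr bits_signature.
rewrite bE; apply: normal_bits_ext => i j /edgesP[ij j10 aij].
have [q10 _ q_adj] := autsP _ qA; have i10 := ltn_trans ij j10.
by rewrite sgn_bits_signature ?q10 ?q_adj.
Qed.

(** * Counting proper 1-colorations by backtracking *)

(* [flip true] is the negation of colors when c stands for c - 1, as in [color 1]. *)
Definition flip (t : bool) (c : nat) : nat := if t then 2 - c else c.

(** The list [c] colors the vertices of index below [size c], and [x] is a candidate color for the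
    vertex of index [size c]. *)
Definition extends (s : nat -> nat -> bool) (c : seq nat) (x : nat) : bool :=
  all (fun j => adjb j (size c) ==> (x != flip (s j (size c)) (nth 0 c j)))
    (iota 0 (size c)).

(** Conflicts are tested at every new vertex, so the search visits only proper partial colorings. *)
Fixpoint count_ext (s : nat -> nat -> bool) (n : nat) (c : seq nat) : nat :=
  if n is m.+1 then
    sumn [seq (if extends s c x then count_ext s m (rcons c x) else 0)
         | x <- iota 0 3]
  else 1.

Lemma color_sg1 t (c : color 1) : color_sg t c = flip t c :> nat.
Proof. by case: t. Qed.

Definition colors (kappa : coloration 1) (m : nat) : seq nat :=
  [seq (kappa (vtx i) : nat) | i <- iota 0 m].

Lemma colors_rcons kappa m (c : seq nat) (x : color 1) :
  (colors kappa m.+1 == rcons c x) = (colors kappa m == c) && (kappa (vtx m) == x).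
Proof. by rewrite /colors -[m.+1]addn1 iotaD map_cat cats1 eqseq_rcons. Qed.

(** Only vertices from [size c] on are tested against their earlier neighbors; for empty [c] and
    [n = 10] this covers every edge. *)
Definition extensions (s : nat -> nat -> bool) (n : nat) (c : seq nat) :
    {set coloration 1} :=
  [set kappa | (colors kappa (size c) == c) &&
     all (fun m => extends s (colors kappa m) (kappa (vtx m))) (iota (size c) n)].

Lemma in_extensions s n c (kappa : coloration 1) :
  (kappa \in extensions s n c) = (colors kappa (size c) == c) &&
     all (fun m => extends s (colors kappa m) (kappa (vtx m))) (iota (size c) n).
Proof. by rewrite inE. Qed.

Lemma card_extensions s n c : all (gtn 3) c -> size c + n = 10 ->
  #|extensions s n c| = count_ext s n c.
Proof.
elim: n c => [|n IH] c c3 szc /=.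
  rewrite addn0 in szc.
  (* A list of length 10 with entries below 3 determines a single coloration. *)
  pose k0 : coloration 1 := [ffun v => inord (nth 0 c (vtx_index v))].
  rewrite -[RHS](cards1 k0); apply: eq_card => k; rewrite !inE andbT szc.
  apply/eqP/eqP => [kc|->].
    apply/ffunP => v; rewrite ffunE -kc (nth_map 0) ?size_iota ?vtx_index_lt //.
    by rewrite nth_iota ?vtx_index_lt // vtx_indexK inord_val.
  apply: (@eq_from_nth _ 0); rewrite size_map size_iota ?szc // => i i10.
  rewrite (nth_map 0) ?size_iota // nth_iota // ffunE vtxK // inordK //.
  by apply: (allP c3); rewrite mem_nth ?szc.
transitivity (\sum_(x < 3) if extends s c x then count_ext s n (rcons c x) else 0);
  last by rewrite !big_ord_recl big_ord0.
(* Split by the color of the next vertex, matching the branches of [count_ext]. *)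
rewrite -sum1_card (partition_big (fun k : coloration 1 => k (vtx (size c))) predT) //=.
apply: eq_bigr => x _; rewrite sum1_card.
transitivity #|if extends s c x then extensions s n (rcons c x) else set0|.
  apply: eq_card => /= k; rewrite -[LHS]/((k \in extensions s n.+1 c) && _).
  move: k => k; rewrite in_extensions [iota _ _]/= [all _ _]/=.
  have [kx|xk] := eqVneq (k (vtx (size c))) x; last first.
    rewrite andbF; case: (extends s c x); rewrite ?in_set0 //.
    by rewrite in_extensions size_rcons colors_rcons (negPf xk) andbF.
  have [kc|kc] := eqVneq (colors k (size c)) c; last first.
    case: (extends s c x); rewrite ?in_set0 //.
    by rewrite in_extensions size_rcons colors_rcons (negPf kc).
  rewrite kc kx andbT; case: (extends s c x); rewrite ?in_set0 //=.
  by rewrite in_extensions size_rcons colors_rcons kc kx !eqxx.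
case: (extends s c x); rewrite ?cards0 //.
by rewrite IH ?size_rcons ?addSnnS // all_rcons c3 andbT; exact: (ltn_ord x).
Qed.

Lemma num_proper_bits b :
  num_proper (bits_signature b) 1 = count_ext (bits_sgn b) 10 [::].
Proof.
rewrite -card_extensions //; apply: eq_card => /= k;
rewrite in_set in_extensions eqxx andTb.
have ext i : i < 10 -> extends (bits_sgn b) (colors k i) (k (vtx i)) =
    all (fun j => adjb j i ==>
      (k (vtx i) != color_sg (sgn (bits_signature b) (vtx j) (vtx i)) (k (vtx j))))
      (iota 0 i).
  move=> i10; rewrite /extends size_map size_iota; apply: eq_in_all => j.
  rewrite mem_iota /= => ji; have j10 := ltn_trans ji i10.
  have [ij|//] := boolP (adjb j i); rewrite /= sgn_bits_signature //.
  by rewrite -val_eqE /= color_sg1 (nth_map 0) ?size_iota // nth_iota.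
apply/properP/allP => [H i|H v w].
  rewrite mem_iota /= => i10; rewrite ext //; apply/allP => j; rewrite mem_iota => /= ji.
  have j10 := ltn_trans ji i10.
  by apply/implyP; rewrite -padj_vtx //; apply: H.
rewrite -[v]vtx_indexK -[w]vtx_indexK.
have := vtx_index_lt v; have := vtx_index_lt w.
move: (vtx_index v) (vtx_index w) => {v w} i j.
have {}H i0 j0 : j0 < 10 -> i0 < j0 -> padj (vtx i0) (vtx j0) ->
    k (vtx j0) != color_sg (sgn (bits_signature b) (vtx i0) (vtx j0)) (k (vtx i0)).
  move=> j010 ij0; rewrite padj_vtx ?(ltn_trans ij0) // => aij.
  have := H j0; rewrite mem_iota ext // => /(_ j010)/allP/(_ i0).
  by rewrite mem_iota aij; apply.
move=> j10 i10; have [ij|ji|->] := ltngtP i j; last by rewrite padjxx.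
  exact: H.
(* [extends] compares a vertex only with earlier ones; since a sign is its own inverse, it can be
   moved to the other side of the constraint. *)
rewrite padj_sym => /(H _ _ i10 ji).
rewrite -(inj_eq (can_inj (@color_sg_can 1 (sgn (bits_signature b) (vtx j) (vtx i))))).
by rewrite color_sg_can eq_sym sgnC.
Qed.

(** * The count separates the classes *)

Lemma num_proper_reps_inj :
  {in reps &, injective (fun r => num_proper (bits_signature r) 1)}.
Proof.
(* The counts stand in the order of [reps], so [rep_of] is a left inverse and six evaluations give
   injectivity. *)
pose rep_of m := nth [::] reps (index m [:: 120; 112; 136; 108; 80; 202]).
have /allP H : all (fun r => rep_of (count_ext (bits_sgn r) 10 [::]) == r) reps
  by vm_compute.
by move=> r r' /H/eqP rE /H/eqP r'E; rewrite !num_proper_bits => eq_n; rewrite -rE eq_n.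
Qed.

(** Equal counts force equal representatives, so the count is a complete invariant. *)
Lemma num_proper1_switching sigma tau :
  num_proper sigma 1 = num_proper tau 1 -> switching_isomorphic sigma tau.
Proof.
have [r rR sr] := switching_classes sigma; have [r' r'R tr'] := switching_classes tau.
rewrite (num_proper_switching _ _ _ sr) (num_proper_switching _ _ _ tr').
move=> /(num_proper_reps_inj r r' rR r'R) rr'; rewrite -rr' in tr'.
exact: switching_isomorphic_trans sr (switching_isomorphic_sym _ _ tr').
Qed.

Close Scope nat_scope.

Theorem theorem9p4 (sigma tau : signature) :
  ~ switching_isomorphic sigma tau ->
  [/\ chromatic_poly sigma <> chromatic_poly tau,
      (chromatic_poly sigma).[3] <> (chromatic_poly tau).[3] &
      num_proper sigma 1 <> num_proper tau 1].
Proof.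
move=> nst; have num_neq : num_proper sigma 1 <> num_proper tau 1.
  by move/num_proper1_switching.
have eval_neq : (chromatic_poly sigma).[3] <> (chromatic_poly tau).[3].
  rewrite -[3]/((2 * 1 + 1)%N%:R) !chromatic_polyP => /eqP.
  by rewrite Num.Theory.eqr_nat => /eqP.
by split=> // pq; apply: eval_neq; rewrite pq.
Qed.
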